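(* Let $\mathcal{C}\subseteq\mathbb{F}[z]^n$ be an $(n,k,\delta)$ convolutional code over $\mathbb{F}=\mathbb{F}_q$ with minimal encoder $G$, controller canonical form $(A,B,C,D)$ and adjacency matrix $\Lambda=\Lambda(G)$. Let $\widehat{\mathcal{C}}$ be the dual code, with minimal encoder $\widehat{G}$, controller canonical form $(\widehat A,\widehat B,\widehat C,\widehat D)$ and adjacency matrix $\widehat\Lambda=\Lambda(\widehat G)=(\widehat\lambda_{X,Y})$. Suppose $\widehat r=\delta$, that is, each Forney index of $\widehat{\mathcal{C}}$ is at most $1$. Then $Q:=-\widehat B^t\widehat D C^t\in \mathrm{GL}_{\delta}(\mathbb{F})$ and \[ \widehat\lambda_{X,Y}=q^{-k}\,\mathbf{H}\big((\mathcal{H}\Lambda^t\mathcal{H}^{-1})_{XQ,YQ}\big)\quad\text{for all }(X,Y)\in\mathbb{F}^\delta\times\mathbb{F}^\delta . \] As a consequence, \[ \widehat\Lambda=q^{-k}\,\mathbf{H}\big(\mathcal{P}(Q)\mathcal{H}\Lambda^t\mathcal{H}^{-1}\mathcal{P}(Q)^{-1}\big), \] where $\mathbf{H}$ is applied entrywise.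
   Context: Let $\mathbb{F}=\mathbb{F}_q$ be a finite field with $q=p^s$ elements ($p$ prime, $s\in\mathbb{N}$). Vectors are row vectors, and $\operatorname{im}M=\{uM\}$ for a constant matrix $M$. Convolutional codes. A $k$-dimensional convolutional code of length $n$ is a submodule $\mathcal{C}=\{uG\mid u\in\mathbb{F}[z]^k\}$ of $\mathbb{F}[z]^n$ where $G\in\mathbb{F}[z]^{k\times n}$ is basic, i.e. $G\tilde G=I_k$ for some $\tilde G\in\mathbb{F}[z]^{n\times k}$; $G$ is called an encoder. The degree $\delta$ of $\mathcal{C}$ is the maximal degree of the $k$-minors of $G$; then $\mathcal{C}$ is an $(n,k,\delta)$ code. An encoder with rows $g_1,\dots,g_k$ is minimal if $\sum_i\deg g_i=\delta$; every code has a minimal encoder, and its row degrees, unique up to ordering, are the Forney indices of $\mathcal{C}$. The dual code is $\widehat{\mathcal{C}}=\{w\in\mathbb{F}[z]^n\mid \sum_j w_jv_j=0\ \forall v\in\mathcal{C}\}$; it is an $(n,n-k,\delta)$ code. Controller canonical form. Let $G$ be a minimal encoder with rows $g_i=\sum_{\nu=0}^{\delta_i}g_{i,\nu}z^\nu$ ($g_{i,\nu}\in\mathbb{F}^n$), ordered so that $\delta_1,\dots,\delta_r>0=\delta_{r+1}=\dots=\delta_k$. For $i\le r$ let $A_i\in\mathbb{F}^{\delta_i\times\delta_i}$ have ones on the first superdiagonal and zeros elsewhere, $B_i=(1,0,\dots,0)\in\mathbb{F}^{\delta_i}$, and let $C_i\in\mathbb{F}^{\delta_i\times n}$ have rows $g_{i,1},\dots,g_{i,\delta_i}$.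 Then $A=\mathrm{diag}(A_1,\dots,A_r)\in\mathbb{F}^{\delta\times\delta}$, $B=\begin{pmatrix}\mathrm{diag}(B_1,\dots,B_r)\\ 0\end{pmatrix}\in\mathbb{F}^{k\times\delta}$, $C\in\mathbb{F}^{\delta\times n}$ is the vertical stack of $C_1,\dots,C_r$, and $D=G(0)\in\mathbb{F}^{k\times n}$. The same definitions are applied to $\widehat{\mathcal{C}}$ with a minimal encoder $\widehat G\in\mathbb{F}[z]^{(n-k)\times n}$. The number $\widehat r$ is defined by $\dim\operatorname{im}\begin{pmatrix}C\\ D\end{pmatrix}=k+\widehat r$; it equals the number of nonzero Forney indices of $\widehat{\mathcal{C}}$. Adjacency matrix. For finite $S\subseteq\mathbb{F}^n$, $\mathrm{we}(S)=\sum_{a\in S}W^{\mathrm{wt}(a)}\in\mathbb{C}[W]_{\le n}$ (polynomials of degree at most $n$), with $\mathrm{wt}$ the Hamming weight and $\mathrm{we}(\emptyset)=0$. $\Lambda(G)=(\lambda_{X,Y})\in\mathbb{C}[W]^{q^\delta\times q^\delta}$ is indexed by $(X,Y)\in\mathbb{F}^\delta\times\mathbb{F}^\delta$ with $\lambda_{X,Y}=\mathrm{we}(\{XC+uD\mid u\in\mathbb{F}^k,\ Y=XA+uB\})$; $\Lambda(\widehat G)$ is defined analogously from $(\widehat A,\widehat B,\widehat C,\widehat D)$ with $u\in\mathbb{F}^{n-k}$. MacWilliams objects. $\mathbf{H}:\mathbb{C}[W]_{\le n}\to\mathbb{C}[W]_{\le n}$, $\mathbf{H}(f)(W)=(1+(q-1)W)^n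 f\big(\tfrac{1-W}{1+(q-1)W}\big)$. Fix a primitive $p$-th root of unity $\zeta\in\mathbb{C}$, let $\tau:\mathbb{F}\to\mathbb{F}_p$, $\tau(a)=\sum_{i=0}^{s-1}a^{p^i}$ be the trace and $\beta(X,Y)=\sum_jX_jY_j$. Then $\mathcal{H}=q^{-\delta/2}\big(\zeta^{\tau(\beta(X,Y))}\big)_{X,Y\in\mathbb{F}^\delta}\in\mathbb{C}^{q^\delta\times q^\delta}$ (an invertible matrix). For $P\in\mathrm{GL}_\delta(\mathbb{F})$, $\mathcal{P}(P)\in\mathrm{GL}_{q^\delta}(\mathbb{C})$ is the permutation matrix with $\mathcal{P}(P)_{X,Y}=1$ if $Y=XP$ and $0$ otherwise. *)

(* Defs.v *)
From HB Require Import structures.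
From mathcomp Require Import all_boot all_order all_algebra all_field.
From mathcomp Require Import complex reals.

Set Implicit Arguments.
Unset Strict Implicit.
Unset Printing Implicit Defensive.

Import GRing.Theory Num.Theory.
Local Open Scope ring_scope.

Section ConvolutionalCodes.
Variable F : fieldType.
Implicit Types n k d : nat.

(* A submodule of F[z]^n, given by its membership predicate. *)
Definition code n := 'rV[{poly F}]_n -> Prop.

Definition basic k n (G : 'M[{poly F}]_(k, n)) : Prop :=
  exists Gt : 'M[{poly F}]_(n, k), G *m Gt = 1%:M.

Definition encoder k n (Co : code n) (G : 'M[{poly F}]_(k, n)) : Prop :=
  basic G /\ (forall v, Co v <-> exists u : 'rV[{poly F}]_k, v = u *m G).

(* Maximal degree of the k-minors; a vanishing minor contributes 0. *)
Definition minors_degree k n (G : 'M[{poly F}]_(k, n)) : nat :=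
  \max_(f : {ffun 'I_k -> 'I_n} |
        [forall i : 'I_k, forall j : 'I_k, (i < j)%N ==> (f i < f j)%N])
     (size (\det (colsub f G))).-1.

Definition conv_code n k d (Co : code n) : Prop :=
  exists2 G : 'M[{poly F}]_(k, n), encoder Co G & minors_degree G = d.

Definition row_degree k n (G : 'M[{poly F}]_(k, n)) (i : 'I_k) : nat :=
  \max_(j < n) (size (G i j)).-1.

Definition minimal_encoder k n (Co : code n) (G : 'M[{poly F}]_(k, n)) : Prop :=
  encoder Co G /\ (\sum_(i < k) row_degree G i)%N = minors_degree G.

Definition pos_rows_first k n (G : 'M[{poly F}]_(k, n)) : Prop :=
  forall i j : 'I_k, (i < j)%N -> (0 < row_degree G j)%N ->
    (0 < row_degree G i)%N.

Definition dual_code n (Co : code n) : code n :=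
  fun w => forall v, Co v -> \sum_(j < n) w 0 j * v 0 j = 0.

(* The blocks below are taken over all k rows: a row of degree 0 gives an     *)
(* empty block, so that only the rows of positive degree contribute.          *)
(* The natural state dimension is the sum of the row degrees, which is only   *)
(* propositionally equal to the degree d of the code; when the two agree,     *)
(* conform_mx is a mere change of type.                                       *)
Definition ccfA d k n (G : 'M[{poly F}]_(k, n)) : 'M[F]_d :=
  conform_mx 0 (\mxdiag_(i < k)
    (\matrix_(a < row_degree G i, b < row_degree G i) (b == a.+1 :> nat)%:R)).

Definition ccfB d k n (G : 'M[{poly F}]_(k, n)) : 'M[F]_(k, d) :=
  conform_mx 0 (\matrix_(i < k) \mxrow_(j < k)
    (\row_(b < row_degree G j) ((i == j) && (b == 0%N :> nat))%:R)).

Definition ccfC d k n (G : 'M[{poly F}]_(k, n)) : 'M[F]_(d, n) :=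
  conform_mx 0 (\mxcol_(i < k)
    (\matrix_(a < row_degree G i, j < n) (G i j)`_a.+1)).

Definition ccfD k n (G : 'M[{poly F}]_(k, n)) : 'M[F]_(k, n) :=
  map_mx (horner_eval 0) G.

End ConvolutionalCodes.

Section AdjacencyMatrix.
Variables (F : finFieldType) (K : numClosedFieldType).
Implicit Types n k d p s : nat.

(* Square matrices indexed by F^d, through the enumeration of 'rV[F]_d. *)
Definition smx (T : Type) d (f : 'rV[F]_d -> 'rV[F]_d -> T) :
    'M[T]_#|{: 'rV[F]_d}| :=
  \matrix_(i, j) f (enum_val i) (enum_val j).

Definition sentry (T : Type) d (M : 'M[T]_#|{: 'rV[F]_d}|) (X Y : 'rV[F]_d) : T :=
  M (enum_rank X) (enum_rank Y).

Lemma smxE (T : Type) d (f : 'rV[F]_d -> 'rV[F]_d -> T) X Y :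
  sentry (smx f) X Y = f X Y.
Proof. by rewrite /sentry mxE !enum_rankK. Qed.

Definition wt n (a : 'rV[F]_n) : nat := #|[set j | a 0 j != 0]|.

Definition we n (S : {set 'rV[F]_n}) : {poly K} := \sum_(a in S) 'X^(wt a).

Definition adjacency d k n (G : 'M[{poly F}]_(k, n)) :
    'M[{poly K}]_#|{: 'rV[F]_d}| :=
  smx (fun X Y : 'rV[F]_d =>
    we [set X *m ccfC d G + u *m ccfD G |
          u : 'rV[F]_k & Y == X *m ccfA d G + u *m ccfB d G]).

(* H(f)(W) = (1 + (q-1)W)^n f((1-W) / (1 + (q-1)W)), denominators cleared;    *)
(* meaningful for deg f <= n, see macwilliamsE.                               *)
Definition macwilliams n (f : {poly K}) : {poly K} :=
  \sum_(i < n.+1)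
    f`_i *: ((1 - 'X) ^+ i * (1 + (#|F|%:R - 1) *: 'X) ^+ (n - i)).

Lemma macwilliamsE n (f : {poly K}) : (size f <= n.+1)%N ->
  let num : {fraction {poly K}} := tofrac (1 - 'X) in
  let den : {fraction {poly K}} := tofrac (1 + (#|F|%:R - 1) *: 'X) in
  tofrac (macwilliams n f)
  = den ^+ n * (map_poly (fun c : K => tofrac c%:P) f).[num / den].
Proof.
move=> sf num den.
have den0 : den != 0.
  rewrite /den tofrac_eq0; apply/eqP => /(congr1 (fun g : {poly K} => g.[0])).
  by rewrite !hornerE => /eqP; rewrite oner_eq0.
rewrite (@horner_coef_wide _ n.+1); last first.
  by apply: leq_trans sf; rewrite size_poly.
rewrite mulr_sumr /macwilliams rmorph_sum /=; apply: eq_bigr => i _.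
rewrite coef_map_id0 ?tofrac0 //.
rewrite -mul_polyC !rmorphM !rmorphXn /= -/num -/den.
have le_in : (i <= n)%N by rewrite -ltnS.
rewrite expr_div_n expfB_cond ?(negbTE den0) // [RHS]mulrCA; congr (_ * _).
by rewrite mulrCA.
Qed.

(* The trace F -> F_p; the sum on the right lies in the prime field of F,     *)
(* where t : 'F_p stands for t%:R, see trFpE.                                 *)
Definition trFp p s (a : F) : 'F_p :=
  odflt 0 [pick t : 'F_p | (t : nat)%:R == \sum_(i < s) a ^+ (p ^ i)].

Lemma trFpE p s (a : F) : prime p -> #|F| = (p ^ s)%N ->
  (trFp p s a : nat)%:R = \sum_(i < s) a ^+ (p ^ i).
Proof.
move=> pr_p cardF; rewrite /trFp; case: pickP => [t /eqP // | nt].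
have chF : p \in [pchar F] by apply: card_finPcharP cardF pr_p.
set x := \sum_(i < s) _ in nt *.
have xp : x ^+ p = x.
  rewrite -(pFrobenius_autE chF) /x rmorph_sum /=.
  under eq_bigr do rewrite pFrobenius_autE -exprM -expnSr.
  case: s cardF @x nt => [|s] cardF _ _; first by rewrite !big_ord0.
  rewrite big_ord_recr /= -cardF expf_card big_ord_recl /= expn0 expr1 addrC.
  by congr (_ + _); apply: eq_bigr => i _.
pose r := map (fun t : 'F_p => (t : nat)%:R : F) (enum 'F_p).
have ur : uniq (x :: r).
  rewrite /= map_inj_uniq ?enum_uniq ?andbT.
    by apply/mapP => -[t _ xE]; move: (nt t); rewrite xE eqxx.
  move=> t1 t2 /eqP; wlog le12 : t1 t2 / (t1 <= t2)%N => [IH|].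
    by case/orP: (leq_total t1 t2) => h e; [|apply/esym]; apply: IH; rewrite // eq_sym.
  rewrite eq_sym -subr_eq0 -natrB // -(dvdn_pcharf chF) => dv.
  apply/val_inj/eqP; rewrite eqn_leq le12 /= -subn_eq0.
  have lt : (t2 - t1 < p)%N.
    by apply: leq_ltn_trans (leq_subr _ _) _; rewrite -[X in (_ < X)%N](Fp_cast pr_p).
  by rewrite -leqn0 leqNgt; apply/negP => /dvdn_leq/(_ dv); rewrite leqNgt lt.
have sP : size ('X^p - 'X : {poly F}) = p.+1.
  by rewrite size_polyDl size_polyXn // size_polyN size_polyX ltnS prime_gt1.
have : (size (x :: r) < size (('X^p - 'X)%R : {poly F}))%N.
  apply: max_poly_roots => //; first by rewrite -size_poly_gt0 sP.
  apply/allP => y; rewrite /root !hornerE inE => /orP[/eqP ->|/mapP[t _ ->]].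
    by rewrite xp subrr.
  by rewrite -(pFrobenius_autE chF) pFrobenius_aut_nat subrr.
by rewrite sP /= size_map -cardE card_Fp // ltnn.
Qed.

Definition fourier_mx p s d (zeta : K) : 'M[K]_#|{: 'rV[F]_d}| :=
  sqrtC #|F|%:R ^- d *:
    smx (fun X Y : 'rV[F]_d => zeta ^+ trFp p s (\sum_(j < d) X 0 j * Y 0 j)).

Definition Pmx d (P : 'M[F]_d) : 'M[K]_#|{: 'rV[F]_d}| :=
  smx (fun X Y : 'rV[F]_d => (Y == X *m P)%:R).

End AdjacencyMatrix.

(* Main.v *)
Require Import Defs.
From HB Require Import structures.
From mathcomp Require Import all_boot all_order all_algebra all_field.
From mathcomp Require Import perm complex reals.

Set Implicit Arguments.
Unset Strict Implicit.
Unset Printing Implicit Defensive.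

Import GRing.Theory Num.Theory.
Local Open Scope ring_scope.

(* The rank hypothesis says that all coefficient vectors of the rows of G are *)
(* linearly independent, i.e. M = col_mx C D is row free.  One can then write *)
(* down d rows of degree at most 1 and n - k - d constant rows in the dual    *)
(* code, independent at z = 0, so the degree of the dual is at most d; as at  *)
(* most n - k - d rows of Gh are constant, all its row degrees are at most 1  *)
(* and add up to d.  Hence Ah = 0 and Gh = Dh + z Bh Ch, and Gh G^T = 0 turns *)
(* into Dh D^T = 0, Dh C^T = - Bh Q, Ch C^T = Q A^T, Ch D^T = Q B^T.  These   *)
(* say that the outputs of the dual from X to Y form the full solution set of *)
(* b C^T = X Q A^T - Y Q, b D^T = X Q B^T, which up to sign is also what      *)
(* character orthogonality selects when the MacWilliams transform is applied  *)
(* to the Fourier transform of Lambda at (X Q, Y Q).                          *)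

(** * Controller canonical form *)

(** Call the triples (state, next state, output) of a realization its edges. As D has full row rank,
    the edges (X, XA+uB, XC+uD) correspond bijectively to the pairs (X,u) and form a block code of
    dimension d+k; Lambda is its weight enumerator refined by the two states. Conjugating Lambda^T
    by the Fourier matrix and applying the MacWilliams transform is block-code duality in the state
    and output coordinates, so the result is, up to the factor q^k, the refined enumerator of the
    orthogonal space. This is [macwilliams_fourier], a consequence of character orthogonality. It
    remains to recognise that space as the edge space of the dual code, after the change of state Q
    and up to signs. [dual_unit_degrees] puts the dual encoder in first-order form,
    [dual_state_relations] compares coefficients, [dual_state_unit] inverts Q by a rank count, and
    [dual_outputP] matches the two spaces. The remaining sign is harmless because the Hamming weight
    ignores it ([we_opp]). *)

Section ControllerForm.
Variables (F : fieldType) (d k n : nat) (G : 'M[{poly F}]_(k, n)).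
Hypothesis sumG : (\sum_(i < k) row_degree G i)%N = d.

(** A state coordinate is decoded as a pair (encoder row, position in its block); the cast is needed
    because d equals the sum of the row degrees only propositionally. *)
Let blk (s : 'I_d) : 'I_k := tagnat.sig1 (cast_ord (esym sumG) s).
Let pos (s : 'I_d) : nat := tagnat.sig2 (cast_ord (esym sumG) s).

Lemma ccf_indexP i v :
  reflect (exists s, blk s = i /\ pos s = v) (v < row_degree G i)%N.
Proof.
apply: (iffP idP) => [lt_v|[s [<- <-]]]; last exact: ltn_ord.
exists (cast_ord sumG (tagnat.Rank _ (Ordinal lt_v))).
by split; rewrite ?/blk ?/pos cast_ordK ?tagnat.Rank1K ?tagnat.Rank2K.
Qed.

Lemma ccf_index_eq s t : (s == t) = (blk s == blk t) && (pos s == pos t).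
Proof.
apply/eqP/andP=> [->//|[/eqP eq1 /eqP eq2]].
apply: (can_inj (cast_ordKV sumG)).
rewrite -[LHS]tagnat.sig2K -[RHS]tagnat.sig2K; apply/val_inj/eqP => /=.
by rewrite tagnat.eq_Rank; apply/andP; split; apply/eqP.
Qed.

Lemma ccfAE s t :
  ccfA d G s t = ((blk s == blk t) && (pos t == (pos s).+1))%:R.
Proof.
(* Eliminating the equation on d turns [conform_mx] and the casts into identities. *)
rewrite /blk /pos /ccfA; case: d / sumG s t => s t.
rewrite conform_mx_id !cast_ord_id mxE.
case: eqP => [e|_] /=; last by rewrite mxE.
move: (tagnat.sig2 s) (tagnat.sig2 t) => a b.
by case: _ / e b => b; rewrite conform_mx_id mxE.
Qed.

Lemma ccfBE i s : ccfB d G i s = ((blk s == i) && (pos s == 0%N))%:R.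
Proof.
rewrite /blk /pos /ccfB; case: d / sumG s => s.
by rewrite conform_mx_id !cast_ord_id !mxE [i == _]eq_sym.
Qed.

Lemma ccfCE s j : ccfC d G s j = (G (blk s) j)`_(pos s).+1.
Proof.
rewrite /blk /pos /ccfC; case: d / sumG s => s.
by rewrite conform_mx_id !cast_ord_id !mxE.
Qed.

(** [ccfB] injects an input at position 0 of its block, and each factor [ccfA] shifts it by one
    position. *)
Lemma ccfBAE v i s :
  (ccfB d G *m ccfA d G ^+ v) i s = ((blk s == i) && (pos s == v))%:R.
Proof.
elim: v i s => [|v IHv] i s; first by rewrite expr0 mulmx1 ccfBE.
rewrite exprSr mulmxA mxE.
under eq_bigr => t _ do rewrite IHv ccfAE -natrM mulnb.
rewrite -natr_sum; congr (_%:R).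
case: (boolP (_ && _)) => [/andP[/eqP <- /eqP eqv]|ne].
  have /ccf_indexP[t [tb tp]] : (v < row_degree G (blk s))%N.
    by apply: ltnW; rewrite -eqv; apply: ltn_ord.
  rewrite (bigD1 t) //= tb tp eqv !eqxx /= big1 // => u ne_ut.
  case: eqP => //= ub; case: eqP => //= up.
  by case/negP: ne_ut; rewrite ccf_index_eq ub up tb tp !eqxx.
rewrite big1 // => t _; case: eqP => //= tb; case: eqP => //= tp.
case: eqP => //= ts; case: eqP => //= ps.
by case/negP: ne; rewrite -ts tb ps tp !eqxx.
Qed.

(** The realization formula: G is D plus the sum of the z^(v+1) B A^v C. *)
Lemma ccf_coef v i j :
  (ccfB d G *m ccfA d G ^+ v *m ccfC d G) i j = (G i j)`_v.+1.
Proof.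
rewrite mxE; under eq_bigr => s _ do rewrite ccfBAE ccfCE.
have [/ccf_indexP[s [sb sp]]|le_v] := boolP (v < row_degree G i)%N.
  rewrite (bigD1 s) //= sb sp !eqxx mul1r big1 ?addr0 // => t ne_ts.
  case: eqP => [tb|]; last by rewrite mul0r.
  case: eqP => [tp|]; last by rewrite mul0r.
  by case/negP: ne_ts; rewrite ccf_index_eq sb sp tb tp !eqxx.
rewrite big1 => [|s _]; last first.
  case: eqP => [sb|]; last by rewrite mul0r.
  case: eqP => [sp|]; last by rewrite mul0r.
  by case/negP: le_v; apply/ccf_indexP; exists s.
rewrite nth_default //; apply: leq_trans (leqSpred _) _; rewrite ltnS.
rewrite -leqNgt in le_v; apply: leq_trans le_v.
exact: (@leq_bigmax _ (fun j => (size (G i j)).-1)).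
Qed.

(** Reachability: every unit vector of the state space occurs as a row of some B A^v. *)
Lemma ccf_reachable m (X : 'M[F]_(m, d)) :
  (forall v, X *m (ccfB d G *m ccfA d G ^+ v)^T = 0) -> X = 0.
Proof.
move=> X0; apply/matrixP=> i s; rewrite mxE.
have /matrixP/(_ i (blk s)) := X0 (pos s); rewrite !mxE => <-.
rewrite (bigD1 s) //= mxE ccfBAE !eqxx mulr1 big1 ?addr0 // => t ne_ts.
by rewrite mxE ccfBAE -ccf_index_eq (negbTE ne_ts) mulr0.
Qed.

Lemma ccf_AB_cancel m (X : 'M[F]_(m, d)) :
  X *m (ccfB d G)^T = 0 -> X *m (ccfA d G)^T = 0 -> X = 0.
Proof.
move=> XB XA; apply: ccf_reachable => -[|v]; first by rewrite expr0 mulmx1.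
by rewrite exprSr mulmxA trmx_mul mulmxA XA mul0mx.
Qed.

Hypothesis unit_degrees : forall i, (row_degree G i <= 1)%N.

Let pos0 s : pos s = 0%N.
Proof.
apply/eqP; rewrite -leqn0 -ltnS.
exact: leq_trans (ltn_ord _) (unit_degrees (blk s)).
Qed.

Lemma ccfA0 : ccfA d G = 0.
Proof. by apply/matrixP=> s t; rewrite ccfAE !pos0 andbF mxE. Qed.

Lemma ccfB_orthonormal : (ccfB d G)^T *m ccfB d G = 1%:M.
Proof.
apply/matrixP=> s t; rewrite !mxE (bigD1 (blk s)) //= big1 => [|i ne_i].
  by rewrite mxE !ccfBE !pos0 !eqxx mul1r addr0 ccf_index_eq !pos0 !andbT eq_sym.
by rewrite mxE !ccfBE eq_sym (negbTE ne_i) mul0r.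
Qed.

End ControllerForm.

(** * Degrees of the dual code *)

Lemma encoder_row_free (F : fieldType) k n (Co : code F n) (G : 'M_(k, n)) :
  encoder Co G -> row_free (ccfD G).
Proof.
case=> -[Gt GGt] _; apply/row_freeP; exists (ccfD Gt).
by rewrite /ccfD -map_mxM GGt map_mx1.
Qed.

Lemma encoder_row (F : fieldType) k n (Co : code F n) (G : 'M_(k, n)) i :
  encoder Co G -> Co (row i G).
Proof. by case=> _ ->; exists (delta_mx 0 i); rewrite rowE. Qed.

(** Write G' = U G. Full rank of G'(0) = U(0) G(0) makes det U nonzero, and each minor of G' is det
    U times the corresponding minor of G. *)
Lemma minors_degree_le_encoder (F : fieldType) k n (Co : code F n)
    (G G' : 'M[{poly F}]_(k, n)) :
    encoder Co G -> (forall i, Co (row i G')) -> row_free (ccfD G') ->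
  (minors_degree G <= minors_degree G')%N.
Proof.
move=> encG CoG' freeG'.
have /fin_all_exists[u uE] i : exists u, row i G' = u *m G by apply/encG.2.
pose U := \matrix_i u i.
have G'E : G' = U *m G by apply/row_matrixP=> i; rewrite row_mul rowK uE.
have detU : \det U != 0.
  have : row_free (ccfD U).
    rewrite -row_leq_rank; apply: leq_trans (mxrankM_maxl _ (ccfD G)).
    by rewrite -map_mxM -G'E row_leq_rank.
  rewrite row_free_unit unitmxE det_map_mx unitfE.
  by apply: contraNneq => ->; rewrite rmorph0.
apply/bigmax_leqP=> f f_incr.
apply: leq_trans (leq_bigmax_cond f f_incr); rewrite {}G'E -mulmx_colsub det_mulmx.
have [->|G0] := eqVneq (\det (colsub f G)) 0; first by rewrite size_poly0.
rewrite size_mul //; move: detU G0; rewrite -!size_poly_gt0.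
case: (size (\det U)) => // a _; case: (size _) => // b _.
by rewrite addSn addnS leq_addl.
Qed.

Lemma minors_degree_encoder (F : fieldType) k n (Co : code F n)
    (G G' : 'M[{poly F}]_(k, n)) :
  encoder Co G -> encoder Co G' -> minors_degree G = minors_degree G'.
Proof.
move=> encG encG'; apply/eqP; rewrite eqn_leq.
by rewrite !(@minors_degree_le_encoder _ _ _ Co) ?(encoder_row_free encG,
  encoder_row_free encG') // => i; apply: encoder_row.
Qed.

Lemma minors_degree_le_row_degree (F : fieldType) k n (G : 'M[{poly F}]_(k, n)) :
  (minors_degree G <= \sum_(i < k) row_degree G i)%N.
Proof.
apply/bigmax_leqP=> f _; rewrite -subn1 leq_subLR.
apply: leq_trans (size_sum _ _ _) _; apply/bigmax_leqP=> s _.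
rewrite mulr_sign (_ : size _ = size (\prod_i (colsub f G) i (s i))); last first.
  by case: ifP => _; rewrite ?size_polyN.
apply: leq_trans (size_poly_prod_leq _ _) _; rewrite card_ord leq_subLR.
rewrite add1n addnS ltnS addnC.
rewrite -[X in (_ <= _ + X)%N](card_ord k) -sum1_card -big_split /=.
apply: leq_sum => i _; rewrite mxE addn1; apply: leq_trans (leqSpred _) _.
by rewrite ltnS; apply: (@leq_bigmax _ (fun j => (size (G i j)).-1)).
Qed.

Lemma dual_codeP (F : fieldType) k n (Co : code F n) (G : 'M[{poly F}]_(k, n)) w :
  encoder Co G -> dual_code Co w <-> w *m G^T = 0.
Proof.
move=> encG; split=> [dual_w|wG v /encG.2[u ->]].
  apply/rowP=> i; rewrite !mxE -[RHS](dual_w _ (encoder_row i encG)).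
  by apply: eq_bigr => j _; rewrite !mxE.
have /matrixP/(_ 0 0) : w *m (u *m G)^T = 0 by rewrite trmx_mul mulmxA wG mul0mx.
rewrite mxE [RHS]mxE => wv0; rewrite -[RHS]wv0.
by apply: eq_bigr => j _; rewrite [in RHS]mxE.
Qed.

(** * First-order polynomial matrices and orthogonality to the code *)

Definition first_order_mx (F : fieldType) m n (W0 W1 : 'M[F]_(m, n)) :
    'M[{poly F}]_(m, n) :=
  map_mx polyC W0 + 'X *: map_mx polyC W1.

Lemma first_order_mxE (F : fieldType) m n (W0 W1 : 'M[F]_(m, n)) i j :
  first_order_mx W0 W1 i j = (W0 i j)%:P + 'X * (W1 i j)%:P.
Proof. by rewrite !mxE. Qed.

Lemma ccfD_first_order (F : fieldType) m n (W0 W1 : 'M[F]_(m, n)) :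
  ccfD (first_order_mx W0 W1) = W0.
Proof.
apply/matrixP=> i j; rewrite mxE first_order_mxE /horner_eval !hornerE.
by rewrite ?mul0r ?addr0.
Qed.

Lemma row_degree_first_order (F : fieldType) m n (W0 W1 : 'M[F]_(m, n)) i :
  (row_degree (first_order_mx W0 W1) i <= (row i W1 != 0)%R)%N.
Proof.
apply/bigmax_leqP=> j _; rewrite first_order_mxE.
have [W1i|_] /= := eqVneq (row i W1) 0.
  have -> : W1 i j = 0 by have /rowP/(_ j) := W1i; rewrite !mxE.
  by rewrite mulr0 addr0 size_polyC; case: (_ != 0).
rewrite -subn1 leq_subLR; apply: leq_trans (size_polyD _ _) _.
rewrite geq_max size_polyC mulrC mul_polyC.
rewrite (leq_trans (size_scale_leq _ _)) ?size_polyX // andbT.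
by case: (_ != 0).
Qed.

Lemma ccf_first_order (F : fieldType) d k n (G : 'M[{poly F}]_(k, n)) :
    (\sum_(i < k) row_degree G i)%N = d -> (forall i, (row_degree G i <= 1)%N) ->
  G = first_order_mx (ccfD G) (ccfB d G *m ccfC d G).
Proof.
move=> sumG degG; apply/matrixP=> i j; apply/polyP=> v.
rewrite first_order_mxE.
have -> : (ccfB d G *m ccfC d G) i j = (G i j)`_1.
  by rewrite -(ccf_coef sumG 0) expr0 mulmx1.
rewrite coefD coefC mulrC coefMX coefC.
case: v => [|[|v]] /=; rewrite ?add0r ?addr0 //.
  by rewrite mxE /horner_eval horner_coef0.
rewrite nth_default //; apply: leq_trans (leqSpred _) _; rewrite ltnS.
apply: leq_trans (leq_trans (degG i) _) => //.
by rewrite (@leq_bigmax _ (fun j => (size (G i j)).-1)).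
Qed.

(** The first two equations are the coefficients of 1 and z. The coefficient of z^(v+2) is the left
    side of the third equation times (B A^v)^T, so reachability condenses all higher coefficients
    into that single equation. *)
Lemma first_order_orthogonal (F : fieldType) d k m n (G : 'M[{poly F}]_(k, n))
    (W0 W1 : 'M[F]_(m, n)) :
    (\sum_(i < k) row_degree G i)%N = d ->
  first_order_mx W0 W1 *m G^T = 0 <->
  [/\ W0 *m (ccfD G)^T = 0,
      W0 *m (ccfC d G)^T *m (ccfB d G)^T + W1 *m (ccfD G)^T = 0 &
      W0 *m (ccfC d G)^T *m (ccfA d G)^T + W1 *m (ccfC d G)^T = 0].
Proof.
move=> sumG.
set A := ccfA d G; set B := ccfB d G; set C := ccfC d G; set D := ccfD G.
pose L v := (B *m A ^+ v)^T.
have LS v : L v.+1 = A^T *m L v by rewrite /L exprSr mulmxA trmx_mul.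
have coefG v : map_mx (coefp v.+1) G^T = C^T *m L v.
  rewrite /L -trmx_mul -map_trmx; congr (_^T).
  by apply/matrixP=> i j; rewrite ccf_coef // mxE.
have coefG0 : map_mx (coefp 0) G^T = D^T.
  rewrite -map_trmx; congr (_^T); apply/matrixP=> i j.
  by rewrite !mxE /horner_eval horner_coef0.
have coefW v : map_mx (coefp v) (first_order_mx W0 W1 *m G^T) =
    W0 *m map_mx (coefp v) G^T +
    (if v is v'.+1 then W1 *m map_mx (coefp v') G^T else 0).
  apply/matrixP=> i j; rewrite /first_order_mx mulmxDl -scalemxAl !mxE /= coefD.
  rewrite mulrC coefMX !coef_sum; congr (_ + _).
    by apply: eq_bigr => l _; rewrite !mxE coefCM.
  by case: v => [|v] /=; rewrite !mxE //; apply: eq_bigr => l _; rewrite !mxE coefCM.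
have coefSS v : map_mx (coefp v.+2) (first_order_mx W0 W1 *m G^T) =
    (W0 *m C^T *m A^T + W1 *m C^T) *m L v.
  by rewrite coefW !coefG LS mulmxDl !mulmxA.
have coef1 : map_mx (coefp 1) (first_order_mx W0 W1 *m G^T) =
    W0 *m C^T *m B^T + W1 *m D^T.
  by rewrite coefW coefG coefG0 /L expr0 mulmx1 mulmxA.
split=> [WG|[WD WCD WCC]].
  split; first by rewrite -coefG0 -[LHS]addr0 -[LHS](coefW 0%N) WG map_mx0.
    by rewrite -coef1 WG map_mx0.
  by apply: (ccf_reachable sumG) => v; rewrite -[LHS]coefSS WG map_mx0.
apply/matrixP=> i j; apply/polyP=> v; rewrite [in RHS]mxE coef0.
transitivity (map_mx (coefp v) (first_order_mx W0 W1 *m G^T) i j).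
  by rewrite [in RHS]mxE.
case: v => [|[|v]]; first by rewrite coefW coefG0 WD addr0 mxE.
  by rewrite coef1 WCD mxE.
by rewrite coefSS WCC mul0mx mxE.
Qed.

(** By [minors_degree_le_encoder] it suffices to exhibit m rows in the dual code, independent at z =
    0, whose degrees add up to at most d. A right inverse of the stacked matrix of C and D allows
    such rows to be solved for. *)
Lemma dual_minors_degree_le (F : fieldType) d k m n (Co : code F n)
    (G : 'M[{poly F}]_(k, n)) (Gh : 'M[{poly F}]_(m, n)) :
    encoder Co G -> (\sum_(i < k) row_degree G i)%N = d ->
    row_free (col_mx (ccfC d G) (ccfD G)) ->
    encoder (dual_code Co) Gh -> (m + k)%N = n ->
  (minors_degree Gh <= d)%N.
Proof.
move=> encG sumG freeM encGh mkn.
set A := ccfA d G; set B := ccfB d G.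
set C := ccfC d G in freeM *; set D := ccfD G in freeM *.
set M := col_mx C D in freeM.
have [R MR] := row_freeP freeM.
have RM : R^T *m M^T = 1%:M by rewrite -trmx_mul MR trmx1.
(* Chosen so that W0 C^T = 1, W0 D^T = 0, W1 C^T = -A^T and W1 D^T = -B^T, which solves the system
   of [first_order_orthogonal]. *)
pose W0 := row_mx 1%:M 0 *m R^T; pose W1 := row_mx (- A^T) (- B^T) *m R^T.
have W0M : W0 *m M^T = row_mx 1%:M 0 by rewrite -mulmxA RM mulmx1.
have W1M : W1 *m M^T = row_mx (- A^T) (- B^T) by rewrite -mulmxA RM mulmx1.
have [N freeN NM] : exists2 N : 'M[F]_(m - d, n), row_free N & N *m M^T = 0.
  have <- : \rank (kermx M^T) = (m - d)%N.
    by rewrite mxrank_ker mxrank_tr (eqP freeM) -mkn subnDr.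
  exists (row_base (kermx M^T)); first exact: row_base_free.
  by apply/sub_kermxP; rewrite eq_row_base.
have dm : (d + (m - d))%N = m.
  apply: subnKC; rewrite -(leq_add2r k) mkn -(eqP freeM).
  exact: rank_leq_col.
move: W0M W1M NM; rewrite !tr_col_mx !mul_mx_row -(row_mx0 _ _ d k).
move=> /eq_row_mx[W0C W0D] /eq_row_mx[W1C W1D] /eq_row_mx[NC ND].
move: W0 W1 W0C W0D W1C W1D => W0 W1 W0C W0D W1C W1D.
move: (m - d)%N N freeN NC ND dm => l N freeN NC ND dm.
move: dm Gh encGh {mkn} => <- Gh encGh.
pose G' := first_order_mx (col_mx W0 N) (col_mx W1 0).
have G'G : G' *m G^T = 0.
  apply/(first_order_orthogonal _ _ sumG); rewrite !mul_col_mx.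
  rewrite -/A -/B -/C -/D.
  rewrite W0C W0D W1C W1D NC ND !mul0mx !mul1mx !add_col_mx.
  by rewrite !subrr !addr0 !col_mx0.
apply: leq_trans (_ : minors_degree G' <= d)%N.
  apply: minors_degree_le_encoder encGh _ _ => [i|].
    by apply/(dual_codeP _ encG); rewrite -row_mul G'G row0.
  rewrite ccfD_first_order -kermx_eq0; apply/rowV0P=> v /sub_kermxP.
  rewrite -[v]hsubmxK mul_row_col => vWN.
  (* Multiplication by C^T is the identity on [W0] and kills [N], so it isolates the coefficients of
     [W0]. *)
  have v0 : lsubmx v = 0.
    have := congr1 (mulmx^~ C^T) vWN.
    by rewrite mulmxDl -!mulmxA W0C NC mulmx1 mulmx0 addr0 mul0mx.
  move: vWN; rewrite v0 mul0mx add0r => vN.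
  have -> : rsubmx v = 0 by apply: (row_free_inj freeN); rewrite mul0mx.
  by rewrite row_mx0.
apply: leq_trans (minors_degree_le_row_degree _) _.
rewrite big_split_ord /= [X in (_ + X)%N]big1 ?addn0 => [|i _].
  rewrite -[X in (_ <= X)%N]card_ord -sum1_card; apply: leq_sum => i _.
  by apply: leq_trans (row_degree_first_order _ _ _) _; case: (_ != 0).
apply/eqP; rewrite -leqn0; apply: leq_trans (row_degree_first_order _ _ _) _.
by rewrite rowKd row0 eqxx.
Qed.

(** Rows of degree 0 are constant vectors orthogonal to all rows of C and D, and they are
    independent, so there are at most m - d of them. At least d rows remain, each adding at least 1
    to a sum bounded by d; equality is forced throughout. *)
Lemma dual_unit_degrees (F : fieldType) d k m n (Co : code F n)
    (G : 'M[{poly F}]_(k, n)) (Gh : 'M[{poly F}]_(m, n)) :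
    encoder Co G -> (\sum_(i < k) row_degree G i)%N = d ->
    row_free (col_mx (ccfC d G) (ccfD G)) ->
    minimal_encoder (dual_code Co) Gh -> (m + k)%N = n ->
  (\sum_(i < m) row_degree Gh i)%N = d /\ forall i, (row_degree Gh i <= 1)%N.
Proof.
move=> encG sumG freeM [encGh sumGh] mkn.
have le_d := dual_minors_degree_le encG sumG freeM encGh mkn.
rewrite -sumGh in le_d.
pose Z := [set i | row_degree Gh i == 0%N].
have cardZ : (#|Z| <= m - d)%N.
  pose f (a : 'I_#|Z|) : 'I_m := enum_val a.
  have freeZ : row_free (rowsub f (ccfD Gh)).
    rewrite -kermx_eq0; apply/rowV0P=> v /sub_kermxP.
    rewrite rowsubE mulmxA => vf0.
    have /rowP vf : v *m rowsub f 1%:M = 0.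
      by apply: (row_free_inj (encoder_row_free encGh)); rewrite mul0mx.
    apply/rowP=> a; have := vf (f a); rewrite !mxE (bigD1 a) //= big1 => [|b ne_ba].
      by rewrite !mxE eqxx mulr1 addr0.
    by rewrite !mxE (inj_eq enum_val_inj) (negbTE ne_ba) mulr0.
  rewrite -[X in (X <= _)%N](eqP freeZ).
  set M := col_mx _ _ in freeM.
  apply: leq_trans (_ : \rank (kermx M^T) <= _)%N; last first.
    by rewrite mxrank_ker mxrank_tr (eqP freeM) -mkn subnDr.
  apply/mxrankS/sub_kermxP; rewrite mul_rowsub_mx.
  apply/row_matrixP=> a; rewrite row_rowsub row0.
  have rowG : row (f a) Gh *m G^T = 0.
    by apply/(dual_codeP _ encG); apply: encoder_row.
  have rowE : row (f a) Gh = first_order_mx (row (f a) (ccfD Gh)) 0.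
    apply/rowP=> j; rewrite first_order_mxE !mxE mulr0 addr0.
    rewrite /horner_eval horner_coef0.
    apply: size1_polyC; apply: leq_trans (leqSpred _) _; rewrite ltnS.
    have : f a \in Z by apply: enum_valP.
    rewrite inE => /eqP <-.
    by apply: (@leq_bigmax _ (fun j => (size (Gh (f a) j)).-1)).
  move: rowG; rewrite rowE => /(first_order_orthogonal _ _ sumG).
  rewrite !mul0mx !addr0 => -[WD WB WA].
  rewrite row_mul tr_col_mx mul_mx_row WD -[RHS](@row_mx0 _ _ d k); congr row_mx.
  exact (ccf_AB_cancel sumG WB WA).
have le_dm : (d <= m)%N.
  by rewrite -(leq_add2r k) mkn -(eqP freeM); apply: rank_leq_col.
pose e i : nat := row_degree Gh i != 0%N.
have ge_d : (d <= \sum_i e i)%N.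
  have -> : \sum_i e i = #|~: Z|.
    rewrite -sum1_card [RHS]big_mkcond; apply: eq_bigr => i _.
    by rewrite !inE /e; case: eqP.
  by rewrite cardsCs setCK card_ord -[X in (X <= _)%N](subKn le_dm) leq_sub2l.
have le_e : (\sum_i e i <= \sum_i row_degree Gh i
    ?= iff [forall i, e i == row_degree Gh i])%N.
  by apply: leqif_sum => i _; split=> //; rewrite /e; case: (row_degree Gh i).
have sum_d : (\sum_i row_degree Gh i)%N = d.
  by apply/eqP; rewrite eqn_leq le_d (leq_trans ge_d le_e).
split=> // i; have := le_e.2.
rewrite eqn_leq le_e sum_d ge_d => /esym/forallP/(_ i)/eqP <-.
by rewrite /e; case: (_ != _).
Qed.

(** * State space of the dual code *)

Section DualState.
Variables (F : fieldType) (d k m n : nat).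
Variables (G : 'M[{poly F}]_(k, n)) (Gh : 'M[{poly F}]_(m, n)).
Hypothesis sumG : (\sum_(i < k) row_degree G i)%N = d.
Hypothesis sumGh : (\sum_(i < m) row_degree Gh i)%N = d.
Hypothesis degGh : forall i, (row_degree Gh i <= 1)%N.
Hypothesis GhG : Gh *m G^T = 0.

Let A := ccfA d G. Let B := ccfB d G. Let C := ccfC d G. Let D := ccfD G.
Let Bh := ccfB d Gh. Let Ch := ccfC d Gh. Let Dh := ccfD Gh.
Let Q : 'M[F]_d := - (Bh^T *m Dh *m C^T).

Lemma dual_state_relations :
  [/\ Dh *m D^T = 0, Dh *m C^T = - (Bh *m Q), Ch *m C^T = Q *m A^T
    & Ch *m D^T = Q *m B^T].
Proof.
have BhBh : Bh^T *m Bh = 1%:M by apply: ccfB_orthonormal.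
have := GhG; rewrite (ccf_first_order sumGh degGh).
move=> /(first_order_orthogonal _ _ sumG); rewrite -/A -/B -/C -/D -/Bh -/Ch -/Dh.
case=> DhD /eqP; rewrite addr_eq0 => /eqP DhB /eqP; rewrite addr_eq0 => /eqP DhA.
have ChC : Ch *m C^T = Q *m A^T.
  by rewrite mulNmx -!mulmxA (mulmxA Dh) DhA mulmxN opprK !mulmxA BhBh mul1mx.
have ChD : Ch *m D^T = Q *m B^T.
  by rewrite mulNmx -!mulmxA (mulmxA Dh) DhB mulmxN opprK !mulmxA BhBh mul1mx.
(* Bh Bh^T need not be the identity, so the formula for Dh C^T does not come from multiplying by
   Bh^T; instead Dh C^T + Bh Q is annihilated by both A^T and B^T. *)
split=> //; apply/eqP; rewrite -addr_eq0; apply/eqP.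
apply: (ccf_AB_cancel sumG); rewrite -/A -/B mulmxDl.
  by rewrite DhB -[Bh *m Q *m _]mulmxA -ChD mulmxA addNr.
by rewrite DhA -[Bh *m Q *m _]mulmxA -ChC mulmxA addNr.
Qed.

Hypotheses (freeD : row_free D) (freeDh : row_free Dh).
Hypothesis freeM : row_free (col_mx C D).
Hypothesis mkn : (m + k)%N = n.

(** Frobenius' rank inequality gives the product of Dh with the transpose of the stacked C, D rank
    at least m + (d + k) - n = d. Its D part vanishes, and its C part is -Bh Q. *)
Lemma dual_state_unit : Q \in unitmx.
Proof.
have [DhD DhC _ _] := dual_state_relations.
have rankDhC : (d <= \rank (Dh *m C^T))%N.
  have := mxrank_mul_min Dh (col_mx C D)^T.
  rewrite mxrank_tr (eqP freeDh) (eqP freeM) addnCA mkn addnK => /leq_trans; apply.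
  by rewrite tr_col_mx mul_mx_row DhD rank_row_mx0.
rewrite -row_free_unit -row_leq_rank; apply: leq_trans rankDhC _.
by rewrite DhC mxrank_opp mxrankM_maxr.
Qed.

(** This describes the edges of the dual by linear equations in the data of the original code; no Ah
    occurs because unit row degrees make it zero. *)
Lemma dual_outputP (X Y : 'rV[F]_d) (b : 'rV[F]_n) :
  (exists2 u : 'rV[F]_m, Y = u *m Bh & b = X *m Ch + u *m Dh) <->
  b *m C^T = X *m Q *m A^T - Y *m Q /\ b *m D^T = X *m Q *m B^T.
Proof.
have [DhD DhC ChC ChD] := dual_state_relations.
have BhBh : Bh^T *m Bh = 1%:M by apply: ccfB_orthonormal.
have outC u : (X *m Ch + u *m Dh) *m C^T = X *m Q *m A^T - u *m Bh *m Q.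
  by rewrite mulmxDl -!mulmxA ChC DhC mulmxN.
have outD u : (X *m Ch + u *m Dh) *m D^T = X *m Q *m B^T.
  by rewrite mulmxDl -!mulmxA ChD DhD mulmx0 addr0.
split=> [[u -> ->]|[bC bD]]; first by rewrite outC outD.
have sb : (b - X *m Ch <= kermx D^T)%MS.
  by apply/sub_kermxP; rewrite mulmxBl bD -(outD 0) mul0mx addr0 subrr.
have sDh : (Dh <= kermx D^T)%MS by apply/sub_kermxP.
(* Both the row space of [Dh] and the kernel of D^T have dimension m = n - k, so the inclusion is an
   equality and b - X Ch has the form u Dh. *)
have := mxrank_leqif_sup sDh => -[_]; rewrite mxrank_ker mxrank_tr.
rewrite (eqP freeDh) (eqP freeD) -[X in (X - _)%N]mkn addnK eqxx => /esym sker.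
have /submxP[u ub] := submx_trans sb sker.
have bE : b = X *m Ch + u *m Dh by rewrite -ub addrC subrK.
exists u => //; apply: (row_free_inj (_ : row_free Q)).
  by rewrite row_free_unit dual_state_unit.
by move: bC; rewrite bE outC => /addrI /oppr_inj.
Qed.

End DualState.

(** * Characters and the MacWilliams transform *)

Lemma natr_Fp_inj (F : finFieldType) p s (t1 t2 : 'F_p) :
    prime p -> #|F| = (p ^ s)%N ->
  (t1 : nat)%:R = (t2 : nat)%:R :> F -> t1 = t2.
Proof.
move=> pr_p cardF e; apply: val_inj => /=.
have chF := card_finPcharP cardF pr_p.
have lt_p (t : 'F_p) : (t < p)%N by rewrite -[X in (_ < X)%N](Fp_cast pr_p).
move: (nat_of_ord t1) (nat_of_ord t2) (lt_p t1) (lt_p t2) e => {t1 t2} a b.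
wlog le_ab : a b / (a <= b)%N => [IH|] lt_a lt_b /eqP e.
  case/orP: (leq_total a b) => h; [|apply/esym]; apply: IH => //; apply/eqP => //.
  by rewrite eq_sym.
move: e; rewrite eq_sym -subr_eq0 -natrB // -(dvdn_pcharf chF) => dv.
apply/eqP; rewrite eqn_leq le_ab /= -subn_eq0 -leqn0 leqNgt.
apply/negP => /dvdn_leq/(_ dv); rewrite leqNgt.
by rewrite (leq_ltn_trans (leq_subr _ _) lt_b).
Qed.

Section DotProduct.
Variable F : fieldType.
Implicit Types m n : nat.

Definition dotrv n (a b : 'rV[F]_n) : F := \sum_(j < n) a 0 j * b 0 j.

Lemma dotrvE n (a b : 'rV[F]_n) : dotrv a b = (a *m b^T) 0 0.
Proof. by rewrite mxE; apply: eq_bigr => j _; rewrite mxE. Qed.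

Lemma dotrvC n (a b : 'rV[F]_n) : dotrv a b = dotrv b a.
Proof. by apply: eq_bigr => j _; rewrite mulrC. Qed.

Lemma dotrvDl n (a b c : 'rV[F]_n) : dotrv (a + b) c = dotrv a c + dotrv b c.
Proof. by rewrite !dotrvE mulmxDl mxE. Qed.

Lemma dotrvDr n (a b c : 'rV[F]_n) : dotrv a (b + c) = dotrv a b + dotrv a c.
Proof. by rewrite dotrvC dotrvDl !(dotrvC a). Qed.

Lemma dotrvNl n (a b : 'rV[F]_n) : dotrv (- a) b = - dotrv a b.
Proof. by rewrite !dotrvE mulNmx mxE. Qed.

Lemma dotrv_mulr m n (a : 'rV[F]_n) (b : 'rV[F]_m) (M : 'M[F]_(m, n)) :
  dotrv a (b *m M) = dotrv (a *m M^T) b.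
Proof. by rewrite !dotrvE trmx_mul mulmxA. Qed.

End DotProduct.

Section MacWilliamsLinear.
Variables (F : finFieldType) (K : numClosedFieldType) (n : nat).

Lemma macwilliamsZ c (f : {poly K}) :
  macwilliams F n (c *: f) = c *: macwilliams F n f.
Proof.
by rewrite scaler_sumr; apply: eq_bigr => i _; rewrite coefZ scalerA.
Qed.

Lemma macwilliams_sum I (r : seq I) (P : pred I) (f : I -> {poly K}) :
  macwilliams F n (\sum_(i <- r | P i) f i) =
  \sum_(i <- r | P i) macwilliams F n (f i).
Proof.
rewrite [RHS]exchange_big; apply: eq_bigr => i _ /=.
by rewrite coef_sum scaler_suml.
Qed.

End MacWilliamsLinear.

Section Character.
Variables (F : finFieldType) (K : numClosedFieldType) (p s : nat) (zeta : K).
Hypotheses (pr_p : prime p) (cardF : #|F| = (p ^ s)%N).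
Hypothesis prim_zeta : p.-primitive_root zeta.

Let chi (a : F) : K := zeta ^+ trFp p s a.
Let q : K := #|F|%:R.

Lemma trFpD (a b : F) : trFp p s (a + b) = trFp p s a + trFp p s b.
Proof.
have chF := card_finPcharP cardF pr_p.
apply: (natr_Fp_inj pr_p cardF).
(* Addition in ['F_p] reduces modulo this expression, which is p only through [Fp_cast]. *)
have modp (x : nat) : (x %% (Zp_trunc (pdiv p)).+2)%:R = x%:R :> F.
  by rewrite Fp_cast // (GRing.natr_mod_pchar chF).
rewrite [in RHS]/= modp natrD !trFpE // -big_split /=.
apply: eq_bigr => i _.
by rewrite exprDn_pchar // pnatX pnatE // chF.
Qed.

Lemma charD a b : chi (a + b) = chi a * chi b.
Proof.
rewrite /chi trFpD -exprD -(prim_expr_mod prim_zeta (_ + _)).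
by congr (zeta ^+ _); congr (_ %% _)%N; apply: Fp_cast.
Qed.

Lemma char0 : chi 0 = 1.
Proof.
have chi_neq0 : chi 0 != 0.
  by apply: expf_neq0; rewrite (prim_root_eq0 prim_zeta) -lt0n prime_gt0.
by apply: (mulfI chi_neq0); rewrite -charD addr0 mulr1.
Qed.

(** The trace is a nonzero polynomial of degree less than q, so it cannot vanish on all of F. *)
Lemma char_nontrivial : exists a, chi a != 1.
Proof.
have s_gt0 : (0 < s)%N.
  by have := finNzRing_gt1 F; rewrite cardF; case: (s).
pose T : {poly F} := \sum_(i < s) 'X^(p ^ i).
have T0 : T != 0.
  apply/eqP => /(congr1 (fun f : {poly F} => f`_1)); rewrite coef0 coef_sum.
  rewrite (bigD1 (Ordinal s_gt0)) //= coefXn expn0 eqxx big1 ?addr0.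
    by apply/eqP/oner_neq0.
  move=> i ne_i; rewrite coefXn eq_sym -(expn0 p) eqn_exp2l ?prime_gt1 //.
  by rewrite -[i == _ :> nat]/(i == Ordinal s_gt0) (negbTE ne_i).
have sizeT : (size T <= p ^ s)%N.
  apply: leq_trans (size_sum _ _ _) _; apply/bigmax_leqP=> i _.
  by rewrite size_polyXn ltn_exp2l ?prime_gt1.
have [a Ta|all0] := pickP (fun a : F => ~~ root T a); last first.
  have : (size (enum F) < size T)%N.
    apply: max_poly_roots => //; last exact: enum_uniq.
    by apply/allP=> a _; have := all0 a; case: root.
  by rewrite -cardE cardF ltnNge sizeT.
exists a; apply: contraNneq Ta => chi1.
have := prim_order_dvd prim_zeta (trFp p s a); rewrite -/(chi a) chi1 eqxx.
rewrite /dvdn modn_small => [/eqP tr0|]; last first.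
  by rewrite -[X in (_ < X)%N](Fp_cast pr_p).
rewrite /root horner_sum; under eq_bigr => i _ do rewrite hornerXn.
by rewrite -(trFpE a pr_p cardF) tr0.
Qed.

Lemma sum_char (a : F) : \sum_b chi (a * b) = if a == 0 then q else 0.
Proof.
have [->|a0] := eqVneq a 0.
  under eq_bigr => b _ do rewrite mul0r char0.
  by rewrite sumr_const.
have [c chi_c] := char_nontrivial.
apply/eqP; have : (chi c - 1) * \sum_b chi (a * b) == 0.
  rewrite mulrBl mul1r mulr_sumr subr_eq0; apply/eqP.
  (* Translating b by a^-1 c multiplies the sum by chi c, which differs from 1. *)
  rewrite [RHS](reindex_inj (addrI (a^-1 * c))); apply: eq_bigr => b _.
  by rewrite mulrDr mulVKf // charD.
by rewrite mulf_eq0 subr_eq0 (negbTE chi_c).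
Qed.

Lemma char_sum I (r : seq I) (P : pred I) (f : I -> F) :
  chi (\sum_(i <- r | P i) f i) = \prod_(i <- r | P i) chi (f i).
Proof. exact: (big_morph _ charD char0). Qed.

Lemma sum_rV_prod (R : comNzRingType) n (f : 'I_n -> F -> R) :
  \sum_(b : 'rV[F]_n) \prod_j f j (b 0 j) = \prod_j \sum_c f j c.
Proof.
rewrite bigA_distr_bigA (reindex (fun b : 'rV[F]_n => [ffun j => b 0 j])) /=.
  by apply: eq_bigr => b _; apply: eq_bigr => j _; rewrite ffunE.
exists (fun g : {ffun 'I_n -> F} => \row_j g j) => [b _|g _].
  by apply/rowP=> j; rewrite mxE ffunE.
by apply/ffunP=> j; rewrite ffunE mxE.
Qed.

Lemma sum_char_dot n (a : 'rV[F]_n) :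
  \sum_b chi (dotrv a b) = if a == 0 then q ^+ n else 0.
Proof.
under eq_bigr => b _ do rewrite /dotrv char_sum.
rewrite (sum_rV_prod (fun j c => chi (a 0 j * c))).
under eq_bigr => j _ do rewrite sum_char.
have [->|a0] := eqVneq a 0.
  under eq_bigr => j _ do rewrite mxE eqxx.
  by rewrite prodr_const card_ord.
have [j aj] : exists j, a 0 j != 0 by apply/rV0Pn.
by rewrite (bigD1 j) //= (negbTE aj) mul0r.
Qed.

Lemma sum_char_wt (x : F) :
  \sum_c (chi (x * c))%:P * (if c != 0 then 'X else 1) =
  if x != 0 then 1 - 'X else 1 + (q - 1) *: 'X.
Proof.
rewrite (bigD1 0) //= eqxx mulr0 char0 mulr1.
under eq_bigr => c c0 do rewrite c0.
rewrite -mulr_suml -rmorph_sum /=.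
have -> : \sum_(c | c != 0) chi (x * c) = (if x == 0 then q else 0) - 1.
  by rewrite -sum_char [in RHS](bigD1 0) //= mulr0 char0 addrAC subrr add0r.
case: eqP => _ /=; last by rewrite sub0r polyCN mulN1r.
by rewrite mul_polyC.
Qed.

(** Character and weight both factor over coordinates, so the sum over b is a product of the
    one-coordinate sums of [sum_char_wt]. *)
Lemma macwilliams_char n (a : 'rV[F]_n) :
  macwilliams F n ('X^(wt a) : {poly K}) = \sum_b chi (dotrv a b) *: 'X^(wt b).
Proof.
have wtE (b : 'rV[F]_n) : 'X^(wt b) =
    \prod_j (if b 0 j != 0 then 'X else 1) :> {poly K}.
  rewrite -big_mkcond prodr_const /wt; congr (_ ^+ _).
  by apply: eq_card => j; rewrite !inE.
have wt_le : (wt a <= n)%N by rewrite -[X in (_ <= X)%N]card_ord max_card.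
rewrite /macwilliams (bigD1 (Ordinal (wt_le : wt a < n.+1)%N)) //=.
rewrite coefXn eqxx scale1r.
rewrite big1 ?addr0 => [|i ne_i]; last first.
  rewrite coefXn; case: eqP => [e|]; last by rewrite scale0r.
  by case/eqP: ne_i; apply: val_inj.
under [RHS]eq_bigr => b _ do
  rewrite /dotrv char_sum wtE -mul_polyC rmorph_prod -big_split.
rewrite (sum_rV_prod (fun j c => (chi (a 0 j * c))%:P * (if c != 0 then 'X else 1))).
under [RHS]eq_bigr => j _ do rewrite sum_char_wt.
rewrite (bigID (fun j => a 0 j != 0)) /=; congr (_ * _).
  under eq_bigr => j aj do rewrite aj.
  by rewrite prodr_const /wt; congr (_ ^+ _); apply: eq_card => j; rewrite !inE.
under eq_bigr => j aj do rewrite (negbTE aj).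
rewrite prodr_const; congr (_ ^+ _).
rewrite -[X in (X - _)%N](card_ord n) /wt -(cardsC [set j | a 0 j != 0]) addKn.
by apply: eq_card => j; rewrite !inE.
Qed.

Lemma macwilliams_fourier d k n (A : 'M[F]_d) (B : 'M[F]_(k, d))
    (C : 'M[F]_(d, n)) (D : 'M[F]_(k, n)) (X Y : 'rV[F]_d) :
    row_free D ->
  macwilliams F n (\sum_Z \sum_Z' (chi (dotrv X Z) * chi (- dotrv Z' Y)) *:
    we K [set Z' *m C + u *m D | u : 'rV[F]_k & Z == Z' *m A + u *m B]) =
  q ^+ (d + k) *:
    we K [set b | (b *m C^T == Y - X *m A^T) && (b *m D^T == - (X *m B^T))].
Proof.
move=> freeD.
pose phi (b : 'rV[F]_n) (Z' : 'rV[F]_d) (u : 'rV[F]_k) :=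
  dotrv (X *m A^T - Y + b *m C^T) Z' + dotrv (X *m B^T + b *m D^T) u.
have phiE b Z' u : chi (phi b Z' u) = chi (dotrv X (Z' *m A + u *m B)) *
    chi (- dotrv Z' Y) * chi (dotrv (Z' *m C + u *m D) b).
  rewrite -!charD; congr chi; rewrite /phi !dotrvDl !dotrvDr !dotrv_mulr.
  rewrite dotrvNl [dotrv (_ *m C) b]dotrvC [dotrv (_ *m D) b]dotrvC !dotrv_mulr.
  by rewrite [dotrv Z' Y]dotrvC addrACA; congr (_ + _); rewrite addrAC.
transitivity (\sum_Z' \sum_u \sum_b chi (phi b Z' u) *: ('X^(wt b) : {poly K})).
  rewrite exchange_big macwilliams_sum; apply: eq_bigr => Z' _ /=.
  rewrite -[X0 in macwilliams F n X0](_ : \sum_u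
    (chi (dotrv X (Z' *m A + u *m B)) * chi (- dotrv Z' Y)) *:
      'X^(wt (Z' *m C + u *m D)) = _).
    rewrite macwilliams_sum; apply: eq_bigr => u _.
    rewrite macwilliamsZ macwilliams_char scaler_sumr; apply: eq_bigr => b _.
    by rewrite scalerA phiE.
  (* Inputs are grouped by next state; row freeness of D makes their outputs distinct, so the set
     inside [we] loses no multiplicity. *)
  rewrite (partition_big (fun u => Z' *m A + u *m B) predT) //=.
  apply: eq_bigr => Z _; rewrite /we big_imset /= => [|u v _ _ /addrI]; last first.
    exact: row_free_inj.
  rewrite scaler_sumr; apply: eq_big => [u|u /eqP <-] //.
  by rewrite inE eq_sym.
under eq_bigr => Z' _ do rewrite exchange_big.
rewrite exchange_big /= /we scaler_sumr [RHS]big_mkcond; apply: eq_bigr => b _.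
(* For fixed b the phase splits into a character of Z' and one of u, whose sums are q^d and q^k when
   both linear forms vanish; otherwise the product is 0. *)
under eq_bigr => Z' _ do rewrite -scaler_suml.
rewrite -scaler_suml inE.
under eq_bigr => Z' _ do under eq_bigr => u _ do rewrite charD.
under eq_bigr => Z' _ do rewrite -mulr_sumr.
rewrite -mulr_suml !sum_char_dot.
have -> : (b *m C^T == Y - X *m A^T) = (X *m A^T - Y + b *m C^T == 0).
  by rewrite [in RHS]addrC addr_eq0 opprB.
have -> : (b *m D^T == - (X *m B^T)) = (X *m B^T + b *m D^T == 0).
  by rewrite [in RHS]addrC addr_eq0.
by case: eqP => _; case: eqP => _; rewrite ?mul0r ?mulr0 ?scale0r // exprD.
Qed.

End Character.

(** * Matrices indexed by states *)

Lemma invmx_eq (R : comUnitRingType) m (M N : 'M[R]_m) :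
  M *m N = 1%:M -> invmx M = N.
Proof.
move=> MN; have [uM _] := mulmx1_unit MN.
by rewrite -[RHS](mulKmx uM) MN mulmx1.
Qed.

Section StateMatrices.
Variables (F : finFieldType) (d : nat).

Lemma smx_ext (T : Type) (M N : 'M[T]_#|{: 'rV[F]_d}|) :
  (forall X Y, sentry M X Y = sentry N X Y) -> M = N.
Proof.
move=> eqMN; apply/matrixP=> i j.
by have := eqMN (enum_val i) (enum_val j); rewrite /sentry !enum_valK.
Qed.

Lemma sentry_mulmx (R : pzSemiRingType) (M N : 'M[R]_#|{: 'rV[F]_d}|) X Y :
  sentry (M *m N) X Y = \sum_Z sentry M X Z * sentry N Z Y.
Proof.
rewrite /sentry mxE (reindex enum_rank) //.
exact/onW_bij/enum_rank_bij.
Qed.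

Lemma sentry_map (R S : Type) (f : R -> S) (M : 'M[R]_#|{: 'rV[F]_d}|) X Y :
  sentry (map_mx f M) X Y = f (sentry M X Y).
Proof. by rewrite /sentry mxE. Qed.

Lemma sentryZ (R : pzSemiRingType) (a : R) (M : 'M[R]_#|{: 'rV[F]_d}|) X Y :
  sentry (a *: M) X Y = a * sentry M X Y.
Proof. by rewrite /sentry mxE. Qed.

Lemma sentry1 (R : pzSemiRingType) X Y :
  sentry (1%:M : 'M[R]_#|{: 'rV[F]_d}|) X Y = (X == Y)%:R.
Proof. by rewrite /sentry mxE (inj_eq enum_rank_inj). Qed.

(** Orthogonality of characters: the inverse uses the opposite character. *)
Lemma invmx_fourier (K : numClosedFieldType) p s (zeta : K) :
    prime p -> #|F| = (p ^ s)%N -> p.-primitive_root zeta ->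
  invmx (fourier_mx F p s d zeta) = sqrtC #|F|%:R ^- d *:
    smx (fun X Y : 'rV[F]_d => zeta ^+ trFp p s (- dotrv X Y : F)).
Proof.
move=> pr_p cardF zetaP; apply: invmx_eq; apply: smx_ext => X Y.
rewrite sentry_mulmx sentry1 /fourier_mx.
under eq_bigr => Z _ do rewrite !sentryZ !smxE mulrACA -(charD pr_p cardF zetaP).
rewrite -mulr_sumr -expr2 exprVn -exprM mulnC exprM sqrtCK.
have q0 : #|F|%:R != 0 :> K by rewrite pnatr_eq0 -lt0n; apply/card_gt0P; exists 0.
under eq_bigr => Z _ do rewrite -/(dotrv X Z) [dotrv Z Y]dotrvC -dotrvNl -dotrvDl.
rewrite (sum_char_dot pr_p cardF zetaP) subr_eq0.
by case: eqP => _; rewrite ?mulr0 // mulVf // expf_neq0.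
Qed.

Lemma invmx_Pmx (K : numClosedFieldType) (P : 'M[F]_d) :
  P \in unitmx -> invmx (Pmx K P) = Pmx K (invmx P).
Proof.
move=> uP; apply: invmx_eq; apply: smx_ext => X Y.
rewrite sentry_mulmx sentry1 (bigD1 (X *m P)) //= big1 => [|Z ne_Z].
  by rewrite !smxE eqxx mul1r addr0 mulmxK // eq_sym.
by rewrite !smxE (negbTE ne_Z) mul0r.
Qed.

Lemma sentry_conj_Pmx (K : numClosedFieldType) (P : 'M[F]_d)
    (M : 'M[{poly K}]_#|{: 'rV[F]_d}|) X Y : P \in unitmx ->
  sentry (map_mx polyC (Pmx K P) *m M *m map_mx polyC (invmx (Pmx K P))) X Y
  = sentry M (X *m P) (Y *m P).
Proof.
move=> uP; rewrite invmx_Pmx // sentry_mulmx (bigD1 (Y *m P)) //= big1 => [|Z ne_Z].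
  rewrite sentry_map smxE mulmxK // eqxx mulr1 addr0.
  rewrite sentry_mulmx (bigD1 (X *m P)) //= big1 => [|Z ne_Z].
    by rewrite sentry_map smxE eqxx mul1r addr0.
  by rewrite sentry_map smxE (negbTE ne_Z) mul0r.
rewrite sentry_map smxE; case: eqP => [YE|]; last by rewrite mulr0.
by case/eqP: ne_Z; rewrite YE mulmxKV.
Qed.

End StateMatrices.

(** * Assembly of the MacWilliams identity *)

Lemma we_opp (F : finFieldType) (K : numClosedFieldType) n (S : {set 'rV[F]_n}) :
  we K [set b | - b \in S] = we K S.
Proof.
rewrite /we [RHS](reindex_inj oppr_inj); apply: eq_big => [b|b _].
  by rewrite inE.
by congr ('X^ _); apply: eq_card => j; rewrite !inE mxE oppr_eq0.
Qed.

Lemma sentry_fourier_conj (F : finFieldType) (K : numClosedFieldType) d p s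
    (zeta : K) (L : 'M[{poly K}]_#|{: 'rV[F]_d}|) X Y :
    prime p -> #|F| = (p ^ s)%N -> p.-primitive_root zeta ->
  let H := fourier_mx F p s d zeta in
  sentry (map_mx polyC H *m L^T *m map_mx polyC (invmx H)) X Y =
  #|F|%:R ^- d *: \sum_Z \sum_Z'
    (zeta ^+ trFp p s (dotrv X Z) * zeta ^+ trFp p s (- dotrv Z' Y : F)) *:
      sentry L Z' Z.
Proof.
move=> pr_p cardF zetaP H; rewrite sentry_mulmx exchange_big scaler_sumr.
apply: eq_bigr => Z' _; rewrite sentry_mulmx mulr_suml scaler_sumr.
apply: eq_bigr => Z _; rewrite !sentry_map invmx_fourier // !sentryZ !smxE.
rewrite -[sentry L^T Z Z']/(L^T _ _) mxE -/(sentry L Z' Z) -/(dotrv X Z).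
rewrite mulrAC -rmorphM mul_polyC mulrACA -expr2 exprVn -exprM mulnC exprM sqrtCK.
by rewrite scalerA.
Qed.

Theorem theorem5p8 (R : realType) (F : finFieldType) (p s : nat) (zeta : R[i])
    (n k d rhat : nat) (Co : code F n)
    (G : 'M[{poly F}]_(k, n)) (Gh : 'M[{poly F}]_(n - k, n)) :
  prime p -> #|F| = (p ^ s)%N -> p.-primitive_root zeta ->
  conv_code k d Co ->
  minimal_encoder Co G -> pos_rows_first G ->
  minimal_encoder (dual_code Co) Gh -> pos_rows_first Gh ->
  \rank (col_mx (ccfC d G) (ccfD G)) = (k + rhat)%N -> rhat = d ->
  let q : R[i] := #|F|%:R in
  let Lambda : 'M[{poly R[i]}]_#|{: 'rV[F]_d}| := adjacency R[i] d G in
  let Lambdah : 'M[{poly R[i]}]_#|{: 'rV[F]_d}| := adjacency R[i] d Gh in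
  let H : 'M[R[i]]_#|{: 'rV[F]_d}| := fourier_mx F p s d zeta in
  let HLH : 'M[{poly R[i]}]_#|{: 'rV[F]_d}| :=
    map_mx polyC H *m Lambda^T *m map_mx polyC (invmx H) in
  let Q : 'M[F]_d := - ((ccfB d Gh)^T *m ccfD Gh *m (ccfC d G)^T) in
  let PQ : 'M[R[i]]_#|{: 'rV[F]_d}| := Pmx R[i] Q in
  [/\ Q \in unitmx,
      forall X Y : 'rV[F]_d,
        sentry Lambdah X Y
        = q ^- k *: macwilliams F n (sentry HLH (X *m Q) (Y *m Q))
    & Lambdah
      = (q ^- k)%:P *: map_mx (macwilliams F n)
          (map_mx polyC PQ *m HLH *m map_mx polyC (invmx PQ))].
Proof.
move=> pr_p cardF zetaP [G0 encG0 minorsG0] [encG minG] _ minGh _ rankM rhat_d.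
move=> q Lambda Lambdah H HLH Q PQ.
rewrite {}rhat_d in rankM.
have sumG : (\sum_(i < k) row_degree G i)%N = d.
  by rewrite minG (minors_degree_encoder encG encG0).
have freeM : row_free (col_mx (ccfC d G) (ccfD G)).
  by rewrite /row_free rankM addnC.
have freeD := encoder_row_free encG.
have mkn : (n - k + k)%N = n.
  by apply: subnK; rewrite -[X in (X <= _)%N](eqP freeD) rank_leq_col.
have [sumGh degGh] := dual_unit_degrees encG sumG freeM minGh mkn.
have [encGh _] := minGh; have freeDh := encoder_row_free encGh.
have GhG : Gh *m G^T = 0.
  apply/row_matrixP=> i; rewrite row_mul row0.
  by apply/(dual_codeP _ encG); apply: encoder_row.
have uQ : Q \in unitmx by apply: dual_state_unit.
have outP := dual_outputP sumG sumGh degGh GhG freeD freeDh freeM mkn.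
have q0 : q != 0 by rewrite pnatr_eq0 -lt0n; apply/card_gt0P; exists 0.
have mainE X Y : sentry Lambdah X Y =
    q ^- k *: macwilliams F n (sentry HLH (X *m Q) (Y *m Q)).
  rewrite sentry_fourier_conj // macwilliamsZ.
  under eq_bigr => Z _ do under eq_bigr => Z' _ do rewrite smxE.
  (* The factor q^(d+k) from orthogonality cancels q^-d, contributed by the two Fourier matrices,
     and q^-k. *)
  rewrite (macwilliams_fourier pr_p cardF zetaP) // !scalerA -/q exprD.
  rewrite -mulrA (mulKf (expf_neq0 d q0)) mulVf ?expf_neq0 //.
  (* The transform selects the b for which -b solves the system of [dual_outputP]; negation
     preserves the enumerator. *)
  rewrite scale1r smxE -[in RHS]we_opp; congr (we _ _).
  apply/setP=> b; rewrite !inE !mulNmx; apply/imsetP/andP.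
    case=> u; rewrite inE ccfA0 // mulmx0 add0r => /eqP Yu bE.
    have [-> ->] := (outP X Y b).1 (ex_intro2 _ _ u Yu bE).
    by rewrite opprB !eqxx.
  case=> /eqP bC /eqP bD; have [] := (outP X Y b).2.
    by split; apply: oppr_inj; rewrite ?bC ?bD ?opprB.
  by move=> u Yu bE; exists u; rewrite // inE ccfA0 // mulmx0 add0r Yu.
split=> //; apply: smx_ext => X Y.
by rewrite sentryZ sentry_map sentry_conj_Pmx // mainE mul_polyC.
Qed.
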